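(* Let $G$ be a cubic graph. Then there is a mapping $f: E(G)\to E(S)$ such that $|V(f)|\geq \frac{4}{5}|V(G)|$, and for every vertex $v\in V(G)\setminus V(f)$ there are two distinct edges $e,e'\in\partial_G(v)$ with $f(e)=f(e')$.
   Context: Graphs are finite, undirected, without loops but possibly with parallel edges; a cubic graph is $3$-regular. $\partial_X(x)$ denotes the set of edges of $X$ incident to the vertex $x$. $S$ is the Sylvester graph on $10$ vertices: it has a central vertex $c$ and, for each $i\in\{1,2,3\}$, vertices $x_i,y_i,z_i$ with two parallel edges between $x_i$ and $y_i$, edges $x_iz_i$, $y_iz_i$, and the edge $z_ic$ ($15$ edges in total). For a map $f:E(G)\to E(S)$, $V(f)=\{x\in V(G): \exists y\in V(S),\ f(\partial_G(x))=\partial_S(y)\}$. *)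

(* Defs.v *)
From mathcomp Require Import all_boot.
Set Implicit Arguments. Unset Strict Implicit. Unset Printing Implicit Defensive.

(* A finite multigraph is given by a finite vertex type V, a finite edge type E
   and two endpoint maps src tgt : E -> V (parallel edges allowed).
   Loops are excluded by the hypothesis [forall e, src e != tgt e]. *)

Definition incident (V E : finType) (src tgt : E -> V) (x : V) : {set E} :=
  [set e | (src e == x) || (tgt e == x)].

Definition loopless (V E : finType) (src tgt : E -> V) : Prop :=
  forall e, src e != tgt e.

(* cubic = 3-regular (for loopless multigraphs the degree is #|incident|) *)
Definition cubic (V E : finType) (src tgt : E -> V) : Prop :=
  forall v, #|incident src tgt v| = 3.

(* ---- The Sylvester graph S ----
   Vertices 'I_10: c = 0, x_i = 3i+1, y_i = 3i+2, z_i = 3i+3 (i = 0,1,2).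
   Edges 'I_15: for i = 0,1,2 edges 5i, 5i+1 : x_i y_i (parallel),
   5i+2 : x_i z_i, 5i+3 : y_i z_i, 5i+4 : z_i c. *)
Definition SV := 'I_10.
Definition SE := 'I_15.

Definition S_c : SV := inord 0.
Definition S_x (i : nat) : SV := inord (3 * i + 1).
Definition S_y (i : nat) : SV := inord (3 * i + 2).
Definition S_z (i : nat) : SV := inord (3 * i + 3).

Definition S_src (e : SE) : SV :=
  let i := e %/ 5 in
  match e %% 5 with
  | 0 | 1 | 2 => S_x i
  | 3 => S_y i
  | _ => S_z i
  end.

Definition S_tgt (e : SE) : SV :=
  let i := e %/ 5 in
  match e %% 5 with
  | 0 | 1 => S_y i
  | 2 | 3 => S_z i
  | _ => S_c
  end.

Definition Vf (V E : finType) (src tgt : E -> V) (f : E -> SE) : {set V} :=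
  [set x | [exists y : SV, f @: incident src tgt x == incident S_src S_tgt y]].

(* Main.v *)
Require Import Defs.
From mathcomp Require Import all_boot.
Set Implicit Arguments. Unset Strict Implicit. Unset Printing Implicit Defensive.

(* A triangle without parallel edges can be contracted: a map for the contracted graph
   extends to the triangle, and two more good vertices appear. So let G have no such
   triangle, and take a proper partial 3-edge-colouring with as few uncoloured edges as
   possible. An uncoloured edge e = xy has distinct missing colours a at x and b at y;
   a Kempe interchange shows that x and y lie on one a/b-alternating chain, and e can be
   shifted to any place on the cycle that this chain closes up with e. By minimality no
   shift may bring two uncoloured edges together, so the chains of distinct uncoloured
   edges are vertex disjoint (Fouquet). Each chain has at least five vertices, unless it is
   a triangle with parallel edges. Such a triangle can be coloured like a block
   {x_i, y_i, z_i} of the Sylvester graph, the edge leaving it being a spoke z_i c. On the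
   other edges the three colours are the three spokes, and each remaining uncoloured edge
   gets the colour missing at one of its ends, so that only its other end is bad. *)

(** * Partial colourings with few uncoloured edges *)

Section Ends.
Variables (V E : finType) (src tgt : E -> V).
Local Notation inc := (incident src tgt).

(** Since [u != v], these are the two ends of [e], in either order; no case analysis on [src] and
    [tgt] is needed later. *)
Definition joins (e : E) (u v : V) : bool :=
  [&& e \in inc u, e \in inc v & u != v].

Lemma joinsE e u v : joins e u v = [&& e \in inc u, e \in inc v & u != v].
Proof. by []. Qed.

Lemma joinsC e u v : joins e u v = joins e v u.
Proof. by rewrite /joins eq_sym; case: (_ \in _); case: (_ \in _). Qed.

Lemma joins_end e u v w : joins e u v -> e \in inc w -> (w == u) || (w == v).
Proof.
case/and3P; rewrite !inE => /orP[]/eqP-> /orP[]/eqP->; rewrite ?eqxx // => _;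
  by rewrite ![_ == w]eq_sym // orbC.
Qed.

Lemma joins_incl e u v : joins e u v -> e \in inc u.
Proof. by case/and3P. Qed.

Lemma joins_incr e u v : joins e u v -> e \in inc v.
Proof. by case/and3P. Qed.

Lemma joins_neq e u v : joins e u v -> u != v.
Proof. by case/and3P. Qed.

Hypothesis Hloop : loopless src tgt.

Lemma joins_src_tgt e : joins e (src e) (tgt e).
Proof. by rewrite /joins !inE !eqxx orbT Hloop. Qed.

Lemma other_end e u : e \in inc u -> exists v, joins e u v.
Proof.
rewrite inE => /orP[]/eqP<-; first by exists (tgt e); apply: joins_src_tgt.
by exists (src e); rewrite joinsC; apply: joins_src_tgt.
Qed.

End Ends.

Section PartialColouring.
Variables (V E : finType) (src tgt : E -> V).
Hypotheses (Hloop : loopless src tgt) (Hcubic : cubic src tgt).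
Local Notation inc := (incident src tgt).
Local Notation joins := (joins src tgt).

Definition colouring := {ffun E -> option 'I_3}.
Implicit Types (c : colouring) (a b : 'I_3) (e f g h : E) (u v w x y z : V).

Definition proper_colouring c : bool :=
  [forall v, forall h in inc v, forall h' in inc v,
    (c h == c h') ==> (c h == None) || (h == h')].

Definition uncoloured c : {set E} := [set e | c e == None].

Definition minimal c : Prop :=
  proper_colouring c /\ forall c', proper_colouring c' -> #|uncoloured c| <= #|uncoloured c'|.

Definition misses c v a : bool := [forall h in inc v, c h != Some a].

(** One step of a Kempe chain; the [connect] classes are the components of the a/b-coloured
    subgraph. *)
Definition chain c a b : rel V := fun u v =>
  [exists h, joins h u v && ((c h == Some a) || (c h == Some b))].

Lemma proper_colouringP c : reflect
  (forall v h h' a, h \in inc v -> h' \in inc v -> c h = Some a -> c h' = Some a ->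
     h = h') (proper_colouring c).
Proof.
apply: (iffP forallP) => [H v h h' a hv h'v ch ch'|H v].
  move/forall_inP/(_ _ hv)/forall_inP/(_ _ h'v): (H v).
  by rewrite ch ch' eqxx /= => /eqP.
apply/forall_inP => h hv; apply/forall_inP => h' h'v.
apply/implyP => /eqP; case ch: (c h) => [a|//] /esym ch'.
by rewrite (H v h h' a) ?eqxx.
Qed.

Lemma missesP c v a : reflect (forall h, h \in inc v -> c h <> Some a) (misses c v a).
Proof.
apply: (iffP forall_inP) => H h hv; first exact/eqP/H.
by apply/eqP/H.
Qed.

Lemma not_misses c v a : ~~ misses c v a -> exists h w, joins h v w /\ c h = Some a.
Proof.
case/forall_inPn => h hv; rewrite negbK => /eqP ch.
by have [w jw] := other_end Hloop hv; exists h, w.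
Qed.

Lemma minimal_exists : exists c, minimal c.
Proof.
pose c0 : colouring := [ffun=> None].
have p0 : proper_colouring c0 by apply/proper_colouringP => v h h' a _ _; rewrite ffunE.
case: (arg_minnP (fun c => #|uncoloured c|) p0) => c pc cmin.
by exists c.
Qed.

Lemma colour_edge_proper c e x y b : proper_colouring c -> joins e x y ->
  misses c x b -> misses c y b ->
  proper_colouring [ffun h => if h == e then Some b else c h].
Proof.
move=> /proper_colouringP pc jxy /missesP mx /missesP my.
apply/proper_colouringP => v h h' a hv h'v.
have me h1 : e \in inc v -> h1 \in inc v -> c h1 <> Some b.
  by move=> /(joins_end jxy) /orP[]/eqP-> h1v; [apply: mx|apply: my].
rewrite !ffunE; case: eqP hv => [->|_] hv; case: eqP h'v => [->|_] h'v //.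
- by move=> [<-] /(me _ hv h'v).
- by move=> ch [ab]; case: (me _ h'v hv); rewrite ab.
- exact: pc hv h'v.
Qed.

(** Giving [b] to [e] would leave fewer uncoloured edges. *)
Lemma no_common_missing c e x y b : minimal c -> c e = None -> joins e x y ->
  misses c x b -> misses c y b -> False.
Proof.
move=> [pc cmin] ce jxy mx my.
have := cmin _ (colour_edge_proper pc jxy mx my); apply/negP; rewrite -ltnNge.
apply: proper_card; apply/properP; split.
  by apply/subsetP => h; rewrite !inE ffunE; case: (h == e).
by exists e; rewrite !inE ?ffunE ?ce ?eqxx.
Qed.

Lemma misses_sees c e x y b : minimal c -> c e = None -> joins e x y ->
  misses c x b -> exists h w, joins h y w /\ c h = Some b.
Proof.
move=> cm ce jxy mx; apply: not_misses; apply/negP => my.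
exact: (no_common_missing cm ce jxy mx my).
Qed.

Lemma misses_neq c e x y a b : minimal c -> c e = None -> joins e x y ->
  misses c x a -> misses c y b -> a != b.
Proof.
move=> cm ce jxy mx my; apply/eqP => ab; rewrite -ab in my.
exact: (no_common_missing cm ce jxy mx my).
Qed.

(** Besides [e] only two edges meet [x], too few to show all three colours. *)
Lemma exists_misses c e x : c e = None -> e \in inc x -> exists a, misses c x a.
Proof.
move=> ce ex; apply/existsP; apply/contraT => /existsPn H.
have sub : [set Some a | a in 'I_3] \subset c @: (inc x :\ e).
  apply/subsetP => _ /imsetP[a _ ->].
  case/forall_inPn: (H a) => h hx; rewrite negbK => /eqP ch; apply/imsetP; exists h => //.
  by rewrite !inE in hx *; rewrite hx andbT; apply: contra_eqN ch => /eqP->; rewrite ce.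
have := leq_trans (subset_leq_card sub) (leq_imset_card _ _).
rewrite card_imset; last by move=> ? ? [].
by rewrite card_ord; have := Hcubic x; rewrite (cardsD1 e) ex add1n => -[->].
Qed.

(** * Shifting an uncoloured edge *)

Definition shift c e f b : colouring :=
  [ffun h => if h == f then None else if h == e then Some b else c h].

(** [f] replaces [e] among the uncoloured edges, so their number is unchanged. For properness,
    uncolour [f] first: then both ends of [e] miss [b]. *)
Lemma shift_minimal c e f x y b : minimal c -> c e = None -> joins e x y ->
  f \in inc x -> c f = Some b -> misses c y b -> minimal (shift c e f b).
Proof.
move=> [pc cmin] ce jxy fx cf my.
have nfe : f != e by apply: contra_eqN cf => /eqP->; rewrite ce.
split.
  pose c0 : colouring := [ffun h => if h == f then None else c h].
  have p0 : proper_colouring c0.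
    apply/proper_colouringP => v h h' a hv h'v; rewrite !ffunE.
    by case: eqP => // _; case: eqP => // _; apply: (proper_colouringP _ pc) hv h'v.
  have m0x : misses c0 x b.
    apply/missesP => h hx; rewrite ffunE; case: eqP => // /eqP hf ch.
    by rewrite ((proper_colouringP _ pc) x h f b) ?eqxx in hf.
  have m0y : misses c0 y b.
    by apply/missesP => h hx; rewrite ffunE; case: eqP => // _; apply: (missesP _ _ _ my).
  have := colour_edge_proper p0 jxy m0x m0y.
  congr is_true; congr proper_colouring; apply/ffunP => h; rewrite !ffunE.
  by case: eqP => [->|//]; rewrite eq_sym (negPf nfe).
move=> c' pc'; apply: leq_trans (cmin c' pc').
have -> : uncoloured (shift c e f b) = f |: (uncoloured c :\ e).
  by apply/setP => h; rewrite !inE ffunE; case: (h == f); case: (h == e).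
by rewrite cardsU1 (cardsD1 e (uncoloured c)) !inE ce cf /= ?andbF ?eqxx.
Qed.

(** [f] was the only [b]-edge at [z], and the newly coloured [e] does not reach [z]: otherwise
    [z = y], and [f] would be a [b]-edge at [y]. *)
Lemma misses_shift c e f x y z b : proper_colouring c -> c e = None -> joins e x y ->
  joins f x z -> c f = Some b -> misses c y b -> misses (shift c e f b) z b.
Proof.
move=> pc ce jxy jf cf my; apply/missesP => h hz; rewrite ffunE.
case: eqP => // /eqP hf; case: eqP => [he|_].
  rewrite he in hz; case/orP: (joins_end jxy hz) => /eqP zE.
    by move: (joins_neq jf); rewrite zE eqxx.
  by case: ((missesP _ _ _ my) f) => //; rewrite -zE (joins_incr jf).
move=> ch; move: hf; rewrite ((proper_colouringP _ pc) z h f b) ?eqxx //.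
exact: joins_incr jf.
Qed.

Lemma misses_shift_other c e f v a b : a != b -> misses c v a -> misses (shift c e f b) v a.
Proof.
move=> ab /missesP m; apply/missesP => h hv; rewrite ffunE.
case: eqP => // _; case: eqP => [_ [ba]|_]; last exact: m.
by rewrite ba eqxx in ab.
Qed.

(* The uncoloured edge is moved one step at a time along the alternating path,
   so that it ends up at the last vertex of the path. *)
Lemma walk p : forall c e x y a b, minimal c -> c e = None -> joins e x y ->
  misses c x a -> misses c y b -> path (chain c a b) x p -> uniq (x :: p) -> p != [::] ->
  exists c' g w, [/\ minimal c', c' g = None, joins g (last x p) w
    & [/\ (c g = Some a) \/ (c g = Some b),
     misses c' w a || misses c' w b, w \in belast x p
    & forall h v, h != g -> h \in inc v -> v \notin y :: belast x p -> c' h = c h]].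
Proof.
elim: p => // z p IH c e x y a b cm ce jxy mx my /= /andP[/existsP[f /andP[jf cf]] pp].
move=> /andP[xzp uzp] _.
have ab := misses_neq cm ce jxy mx my.
(* As [x] misses [a], the path leaves [x] by colour [b]. *)
have {}cf : c f = Some b.
  case/orP: cf => /eqP // cf.
  by case: ((missesP _ _ _ mx) f (joins_incl jf)).
have nfe : f != e by apply: contra_eqN cf => /eqP->; rewrite ce.
pose c1 := shift c e f b.
have c1m : minimal c1 := shift_minimal cm ce jxy (joins_incl jf) cf my.
have c1f : c1 f = None by rewrite ffunE eqxx.
have c1E h : h != f -> h != e -> c1 h = c h by rewrite ffunE => /negPf-> /negPf->.
have m1z : misses c1 z b := misses_shift (proj1 cm) ce jxy jf cf my.
have m1x : misses c1 x a := misses_shift_other e f ab mx.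
have jzx : joins f z x by rewrite joinsC.
case: p => [|u p] in IH pp xzp uzp *.
  exists c1, f, x; split=> //; split; rewrite ?m1x ?mem_head //; first by right.
  move=> h v hf hv; rewrite !inE negb_or => /andP[vy vx]; apply: c1E => //.
  apply/eqP => he; rewrite he in hv.
  by case/orP: (joins_end jxy hv); apply/negP.
(* The remaining path avoids [x], so the shift left its edges alone. The colours swap roles, as now
   [z] misses [b] and [x] misses [a]. *)
have pp1 : path (chain c1 b a) z (u :: p).
  have sub : {in predC1 x &, subrel (chain c a b) (chain c1 b a)}.
    move=> s t; rewrite !inE => sx tx /existsP[h /andP[jh ch]].
    apply/existsP; exists h; rewrite jh /= c1E; first by rewrite orbC.
      apply/eqP => hf; move: jh; rewrite hf => jh.
      case/orP: (joins_end jh (joins_incl jf)) => /eqP xE; [move: sx|move: tx];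
      by rewrite xE eqxx.
    by case/orP: ch => /eqP ch; apply: contra_eqN ch => /eqP->; rewrite ce.
  apply: (sub_in_path sub) pp.
  by apply/allP => t tin; rewrite !inE; apply: contraNneq xzp => <-.
have [c' [g [w [c'm c'g jg [c1g mw wb c'E]]]]] :=
  IH c1 f z x b a c1m c1f jzx m1z m1x pp1 uzp isT.
have lastin : last z (u :: p) \in z :: u :: p by rewrite mem_last.
have win : w \in z :: u :: p by apply: mem_belast.
have ngf : g != f by apply/eqP => gf; move: c1g; rewrite gf c1f; case.
have nge : g != e.
  apply/eqP => ge; have := joins_end jg; rewrite ge => /(_ x (joins_incl jxy)).
  by case/orP=> /eqP xE; move: xzp; rewrite xE ?lastin ?win.
exists c', g, w; split=> //; split.
- by rewrite -c1E //; case: c1g; auto.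
- by rewrite orbC.
- by rewrite inE wb orbT.
- move=> h v hg hv vin.
  have vin' : v \notin x :: belast z (u :: p) by move: vin; rewrite inE negb_or => /andP[].
  rewrite (c'E h v hg hv vin'); apply: c1E.
    apply/eqP => hf; rewrite hf in hv; case/orP: (joins_end jf hv) => /eqP vE;
    by move: vin'; rewrite vE !inE eqxx ?orbT.
  apply/eqP => he; rewrite he in hv; case/orP: (joins_end jxy hv) => /eqP vE;
  by move: vin; rewrite vE !inE eqxx ?orbT.
Qed.

(** * Alternating chains of uncoloured edges *)

Lemma chain_sym c a b : symmetric (chain c a b).
Proof. by move=> u v; apply: eq_existsb => h; rewrite joinsC. Qed.

Lemma chain_edge c a b h u v : joins h u v -> (c h == Some a) || (c h == Some b) ->
  chain c a b u v.
Proof. by move=> j ch; apply/existsP; exists h; rewrite j. Qed.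

(* Otherwise interchanging [a] and [b] on the component of [x] frees a colour for [e]. *)
Lemma ends_connected c e x y a b : minimal c -> c e = None -> joins e x y ->
  misses c x a -> misses c y b -> connect (chain c a b) x y.
Proof.
move=> cm ce jxy mx my; apply/contraT => ncxy.
have ab := misses_neq cm ce jxy mx my.
pose K := connect (chain c a b) x.
pose sw d := if d == Some a then Some b else if d == Some b then Some a else d.
pose c1 : colouring := [ffun h => if K (src h) then sw (c h) else c h].
have swK : involutive sw.
  move=> d; rewrite /sw; case: (d =P Some a) => [->|na].
    by rewrite (inj_eq Some_inj) eq_sym (negPf ab) eqxx.
  by case: (d =P Some b) => [->|nb]; rewrite ?eqxx //; case: eqP => // _; case: eqP.
have K_step u v : chain c a b u v -> K u = K v.
  move=> uv; apply/idP/idP => Ku; apply: connect_trans Ku _; apply: connect1 => //.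
  by rewrite chain_sym.
(* [c1] consults only [src h], but either end decides alike: an edge coloured [a] or [b] has both
   ends in [K] or neither, and [sw] fixes the other values. *)
have c1E h v : h \in inc v -> c1 h = if K v then sw (c h) else c h.
  move=> hv; rewrite ffunE.
  have [ch|] := boolP ((c h == Some a) || (c h == Some b)); last first.
    by rewrite negb_or /sw => /andP[/negPf-> /negPf->]; rewrite !if_same.
  case/orP: (joins_end (joins_src_tgt Hloop h) hv) => /eqP-> //.
  by rewrite (K_step _ _ (chain_edge (joins_src_tgt Hloop h) ch)).
have pc := proj1 cm.
have pc1 : proper_colouring c1.
  apply/proper_colouringP => v h h' d hv h'v; rewrite !(c1E _ v) //.
  case: (K v); last exact: (proper_colouringP _ pc) hv h'v.
  move=> ch ch'; have cc : c h = c h' by rewrite -[c h]swK ch -ch' swK.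
  case ch'd : (c h') => [d'|].
    by apply: ((proper_colouringP _ pc) v h h' d') => //; rewrite cc.
  by move: ch'; rewrite ch'd.
have swN d : (sw d == None) = (d == None).
  by rewrite /sw; case: (d =P Some a) => [->//|_]; case: (d =P Some b) => [->|].
have unE : uncoloured c1 = uncoloured c.
  by apply/setP => h; rewrite !inE ffunE; case: (K _).
have c1m : minimal c1 by split=> // c' /(proj2 cm); rewrite unE.
have c1e : c1 e = None by apply/eqP; have := in_set (fun h => c1 h == None) e;
  move: unE => /setP/(_ e); rewrite !inE ce => ->.
(* After the interchange [x] misses [b], and [y], lying outside [K], still does. *)
suff: False by []; apply: (no_common_missing (b := b) c1m c1e jxy).
  apply/missesP => h hx; rewrite (c1E h x hx) /K connect0 => ch.
  case: ((missesP _ _ _ mx) h hx); rewrite -[c h]swK ch /sw.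
  by rewrite (inj_eq Some_inj) eq_sym (negPf ab) eqxx.
apply/missesP => h hy; rewrite (c1E h y hy) /K (negPf ncxy).
exact: (missesP _ _ _ my).
Qed.

Lemma pigeon3 (s : seq 'I_3) : size s < 3 -> exists a, a \notin s.
Proof.
move=> ss; apply/existsP; apply/contraT => /existsPn H.
have : #|'I_3| <= size s.
  apply: leq_trans (card_size s); apply/subset_leq_card/subsetP => a _.
  by move: (H a); rewrite negbK.
by rewrite card_ord leqNgt ss.
Qed.

Lemma third_edge e f v : e != f -> e \in inc v -> f \in inc v ->
  exists g, [/\ g != e, g != f & inc v = [set e; f; g]].
Proof.
move=> ef ev fv; have := Hcubic v.
rewrite (cardsD1 e) ev (cardsD1 f) !inE eq_sym ef /=; move: (fv); rewrite inE => -> /=.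
rewrite !add1n => -[/eqP/cards1P[g gE]]; exists g.
have : g \in inc v :\ e :\ f by rewrite gE set11.
rewrite !inE => /and3P[gf ge gv]; split=> //.
apply/setP => h; move/setP/(_ h): gE; rewrite !inE => <-.
case: (h =P e) => [->|]; first by move: ev; rewrite inE.
by case: (h =P f) => [->|] //; move: fv; rewrite inE.
Qed.

(** If [e] and [f] differ, [x] sees at most one colour [d], so the far ends [y] and [z] can miss
    nothing but [d]. For [a] other than [d], the a/d-chain from [x] reaches [z]. Walking [e] along
    it to [z] uncolours the [a]-edge there, so [z] misses both [a] and [d]; the other end of the
    moved edge misses one of them, against minimality. *)
Lemma uncoloured_matching c e f x : minimal c -> c e = None -> c f = None ->
  e \in inc x -> f \in inc x -> e = f.
Proof.
move=> cm ce cf ex fx; apply/eqP; apply/contraT => ef; exfalso.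
have [d dP] : exists d, forall v a, e \in inc v -> f \in inc v -> v = x -> a != d -> misses c v a.
  have [g [ge gf gE]] := third_edge ef ex fx.
  (* If the third edge is uncoloured too, [x] misses every colour and any [d] serves. *)
  exists (odflt ord0 (c g)) => v a _ _ -> ad; apply/missesP => h; rewrite gE !inE.
  case/orP => [/orP[]/eqP->|/eqP-> cg]; rewrite ?ce ?cf //.
  by rewrite cg /= eqxx in ad.
have [y jxy] := other_end Hloop ex; have [z jxz] := other_end Hloop fx.
have only_d h w a : c h = None -> joins h x w -> misses c w a -> a = d.
  move=> ch jh mw; apply/eqP/contraT => ad.
  by case: (no_common_missing cm ch jh (dP _ _ ex fx erefl ad) mw).
(* Were [e] and [f] parallel, only the third edge at [y] could be coloured, and [y] would miss a
   colour other than [d]. *)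
have yz : y != z.
  apply/eqP => yz; have ey := joins_incr jxy; have fy := joins_incr jxz; rewrite -yz in fy.
  have [g [ge gf gE]] := third_edge ef ey fy.
  have [a] := @pigeon3 [:: d; odflt ord0 (c g)] isT.
  rewrite !inE negb_or => /andP[ad ag]; move: (ad); rewrite (only_d e y a) ?eqxx //.
  apply/missesP => h; rewrite gE !inE.
  case/orP => [/orP[]/eqP->|/eqP-> cg]; rewrite ?ce ?cf //.
  by rewrite cg /= eqxx in ag.
have [a] := @pigeon3 [:: d] isT; rewrite inE => ad.
have mx : misses c x a := dP _ _ ex fx erefl ad.
have my : misses c y d.
  by have [b mb] := exists_misses ce (joins_incr jxy); rewrite -(only_d _ _ _ ce jxy mb).
have mz : misses c z d.
  by have [b mb] := exists_misses cf (joins_incr jxz); rewrite -(only_d _ _ _ cf jxz mb).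
have /connectP[p0 pp0 zE] := ends_connected cm cf jxz mx mz.
case: (shortenP pp0) zE => p pp up _ zE {p0 pp0}.
have pn : p != [::] by apply/eqP => pE; move: (joins_neq jxz); rewrite zE pE eqxx.
have [c' [g [w [c'm c'g]]]] := walk cm ce jxy mx my pp up pn.
rewrite -zE => jg [cg mw wb c'E].
have zout : z \notin y :: belast x p.
  rewrite inE negb_or eq_sym yz /=; move: up; rewrite lastI rcons_uniq -zE.
  by case/andP.
have {}cg : c g = Some a.
  by case: cg => // cg; case: ((missesP _ _ _ mz) g (joins_incl jg)).
have mza : misses c' z a.
  apply/missesP => h hz; have [->|hg] := eqVneq h g; first by rewrite c'g.
  rewrite (c'E h z) // => ch; case/eqP: hg.
  exact: ((proper_colouringP _ (proj1 cm)) z h g a hz (joins_incl jg)).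
have mzd : misses c' z d.
  apply/missesP => h hz; have [->|hg] := eqVneq h g; first by rewrite c'g.
  by rewrite (c'E h z) //; apply: (missesP _ _ _ mz).
by case/orP: mw => mw; [apply: (no_common_missing c'm c'g jg mza)
  | apply: (no_common_missing c'm c'g jg mzd)].
Qed.

(** Otherwise walking [e] to [v] produces a minimal colouring with two uncoloured edges at [v], the
    moved one and [f]. *)
Lemma chain_avoids c e x y a b v f : minimal c -> c e = None -> joins e x y ->
  misses c x a -> misses c y b -> connect (chain c a b) x v ->
  f \in inc v -> c f = None -> f = e.
Proof.
move=> cm ce jxy mx my /connectP[p0 pp0 vE] fv cf.
have [vx|vx] := eqVneq v x.
  by apply: (uncoloured_matching cm cf ce fv); rewrite vx (joins_incl jxy).
have [vy|vy] := eqVneq v y.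
  by apply: (uncoloured_matching cm cf ce fv); rewrite vy (joins_incr jxy).
case: (shortenP pp0) vE => p pp up _ vE {p0 pp0}.
have pn : p != [::] by apply/eqP => pE; move: vx; rewrite vE pE eqxx.
have [c' [g [w [c'm c'g]]]] := walk cm ce jxy mx my pp up pn.
rewrite -vE => jg [cg mw wb c'E].
have vout : v \notin y :: belast x p.
  by rewrite inE negb_or vy /=; move: up; rewrite lastI rcons_uniq -vE; case/andP.
have gf : g = f; last by move: cg; rewrite gf cf; case.
apply/eqP/contraT => gf.
have c'f : c' f = None by rewrite (c'E f v) // eq_sym.
by move: gf; rewrite (uncoloured_matching c'm c'g c'f (joins_incl jg) fv) eqxx.
Qed.

(** If the chains meet, walk [e'] along its own chain to the first vertex [u] on the chain [K] of
    [e]. The part of [K] from [x] to [u] survives, so [u] is on the chain of [e] and meets another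
    uncoloured edge, against [chain_avoids]. *)
Lemma chains_disjoint c e x y a b e' x' y' a' b' v : minimal c ->
  c e = None -> joins e x y -> misses c x a -> misses c y b ->
  c e' = None -> joins e' x' y' -> misses c x' a' -> misses c y' b' -> e != e' ->
  connect (chain c a b) x v -> connect (chain c a' b') x' v -> False.
Proof.
move=> cm ce j mx my ce' j' mx' my' ee' cxv /connectP[p0 pp0 vE].
pose K := connect (chain c a b) x.
have nK w : e' \in inc w -> ~~ K w.
  move=> e'w; apply/negP => Kw; case/eqP: ee'.
  by rewrite (chain_avoids cm ce j mx my Kw e'w ce').
case: (shortenP pp0) vE => p pp up _ vE {p0 pp0}.
have hasK : has K p.
  case: p vE {pp up} => [/= vE|u p vE].
    by move: (nK x' (joins_incl j')); rewrite -vE /K cxv.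
  by apply/hasP; exists v => //; rewrite vE; apply: (mem_last u p).
(* Stopping at the first vertex in [K] keeps all earlier changes away from [K]. *)
case: (split_find hasK) pp up => u p1 p2 Ku nKp1.
rewrite -cat_cons cat_uniq cat_path => /andP[pp _] /and3P[up _ _] {vE hasK p p2}.
have pn : rcons p1 u != [::] by case: (p1).
have [c' [g [w [c'm c'g]]]] := walk cm ce' j' mx' my' pp up pn.
rewrite last_rcons belast_rcons => jg [cg mw wb c'E].
have Kout t : K t -> t \notin y' :: x' :: p1.
  move=> Kt; rewrite !inE !negb_or; apply/and3P; split.
  - by apply: contraL Kt => /eqP->; apply: nK (joins_incr j').
  - by apply: contraL Kt => /eqP->; apply: nK (joins_incl j').
  - by apply/negP => tp; move/hasPn/(_ t tp): nKp1; rewrite Kt.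
have nKw : ~~ K w.
  by apply/negP => /Kout; rewrite inE negb_or wb andbF.
have c'K t h : K t -> h \in inc t -> h != g -> c' h = c h.
  by move=> Kt ht hg; apply: (c'E h t) => //; apply: Kout.
have Kxy : K y := ends_connected cm ce j mx my.
have Kx : K x by apply: connect0.
have ge : e != g by apply/eqP => ge; move: cg; rewrite -ge ce; case.
have c'e : c' e = None by rewrite (c'K x) // (joins_incl j).
have misses' t d : K t -> misses c t d -> misses c' t d.
  move=> Kt mt; apply/missesP => h ht; have [->|hg] := eqVneq h g; first by rewrite c'g.
  by rewrite (c'K t) //; apply: (missesP _ _ _ mt).
have conn' : connect (chain c' a b) x u.
  case/connectP: (Ku) => q pq uE; apply/connectP; exists q => //.
  have allK : all K (x :: q).
    by apply/allP => t; apply: path_connect.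
  apply: (@sub_in_path _ K) allK pq => s t Ks Kt /existsP[h /andP[jh ch]].
  have {}Ks : K s by []; have {}Kt : K t by [].
  apply/existsP; exists h; rewrite jh (c'K s) ?(joins_incl jh) //.
  (* The moved edge [g] has its end [w] outside [K], so no path inside [K] uses it. *)
  apply/eqP => hg; rewrite hg in jh; case/orP: (joins_end jh (joins_incr jg)) => /eqP wE;
  by move: nKw; rewrite wE ?Ks ?Kt.
have := chain_avoids c'm c'e j (misses' _ _ Kx mx) (misses' _ _ Kxy my) conn'
  (joins_incl jg) c'g.
by move=> gE; rewrite gE eqxx in ge.
Qed.

End PartialColouring.

(** * Vertex stars of the Sylvester graph *)

Definition S_star (p q r : SE) : bool :=
  [exists y : SV, [set p; q; r] == incident S_src S_tgt y].

(** Edge [j] of block [i]: 0 and 1 are the parallel pair, 2 and 3 lead to z_i, and 4 is the spoke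
    z_i c. *)
Definition S_edge (i j : nat) : SE := inord (5 * i + j).

Lemma S_srcE (e : SE) :
  val (S_src e) = nth 0 [:: 1; 1; 1; 2; 3; 4; 4; 4; 5; 6; 7; 7; 7; 8; 9] e.
Proof.
case: e => m; do 15![case: m => [|m]; first by move=> ?; rewrite /S_src /= inordK].
by move=> m15; have := m15; rewrite !ltnS.
Qed.

Lemma S_tgtE (e : SE) :
  val (S_tgt e) = nth 0 [:: 2; 2; 3; 3; 0; 5; 5; 6; 6; 0; 8; 8; 9; 9; 0] e.
Proof.
case: e => m; do 15![case: m => [|m]; first by move=> ?; rewrite /S_tgt /= inordK].
by move=> m15; have := m15; rewrite !ltnS.
Qed.

(** Tabulated ends reduce each star of S to a closed test on naturals, decided by computation. *)
Lemma S_star_inord (m1 m2 m3 y : nat) : [&& m1 < 15, m2 < 15, m3 < 15 & y < 10] ->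
  all (fun e => (e \in [:: m1; m2; m3]) ==
    ((nth 0 [:: 1; 1; 1; 2; 3; 4; 4; 4; 5; 6; 7; 7; 7; 8; 9] e == y)
    || (nth 0 [:: 2; 2; 3; 3; 0; 5; 5; 6; 6; 0; 8; 8; 9; 9; 0] e == y))) (iota 0 15) ->
  S_star (inord m1) (inord m2) (inord m3).
Proof.
case/and4P=> m1lt m2lt m3lt ylt /allP H; apply/existsP; exists (inord y).
apply/eqP/setP => e; move: (H e); rewrite mem_iota /= add0n ltn_ord => /(_ isT)/eqP.
by rewrite !inE -orbA -!val_eqE /= S_srcE S_tgtE !inordK.
Qed.

Lemma S_star_c : S_star (S_edge 0 4) (S_edge 1 4) (S_edge 2 4).
Proof. exact: (@S_star_inord _ _ _ 0). Qed.

Lemma S_star_x i : i < 3 -> S_star (S_edge i 0) (S_edge i 1) (S_edge i 2).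
Proof.
by case: i => [|[|[|//]]] _; [exact: (@S_star_inord _ _ _ 1)
  | exact: (@S_star_inord _ _ _ 4) | exact: (@S_star_inord _ _ _ 7)].
Qed.

Lemma S_star_y i : i < 3 -> S_star (S_edge i 0) (S_edge i 1) (S_edge i 3).
Proof.
by case: i => [|[|[|//]]] _; [exact: (@S_star_inord _ _ _ 2)
  | exact: (@S_star_inord _ _ _ 5) | exact: (@S_star_inord _ _ _ 8)].
Qed.

Lemma S_star_z i : i < 3 -> S_star (S_edge i 2) (S_edge i 3) (S_edge i 4).
Proof.
by case: i => [|[|[|//]]] _; [exact: (@S_star_inord _ _ _ 3)
  | exact: (@S_star_inord _ _ _ 6) | exact: (@S_star_inord _ _ _ 9)].
Qed.

Lemma S_starC p q r : S_star p q r = S_star q p r.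
Proof. by rewrite /S_star (setUC [set p]). Qed.

Lemma S_starAC p q r : S_star p q r = S_star p r q.
Proof. by rewrite /S_star setUAC. Qed.

Lemma S_star_through p : exists q r, S_star p q r.
Proof.
have i3 : p %/ 5 < 3 by rewrite ltn_divLR //; apply: (ltn_ord p).
have -> : p = S_edge (p %/ 5) (p %% 5).
  by apply/val_inj; rewrite /S_edge /= inordK mulnC -divn_eq.
have : p %% 5 < 5 by rewrite ltn_mod.
case: (p %% 5) => [|[|[|[|[|k]]]]] // _.
- by exists (S_edge (p %/ 5) 1), (S_edge (p %/ 5) 2); apply: S_star_x.
- by exists (S_edge (p %/ 5) 0), (S_edge (p %/ 5) 2); rewrite S_starC; apply: S_star_x.
- by exists (S_edge (p %/ 5) 3), (S_edge (p %/ 5) 4); apply: S_star_z.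
- by exists (S_edge (p %/ 5) 2), (S_edge (p %/ 5) 4); rewrite S_starC; apply: S_star_z.
- exists (S_edge (p %/ 5) 2), (S_edge (p %/ 5) 3).
  by rewrite S_starC S_starAC; apply: S_star_z.
Qed.

(** * Graphs in which every triangle has parallel edges *)

(** Double counting of the pairs with [v \in A i]: each [v] occurs at most once. *)
Lemma leq_card_disjoint (I T : finType) (P : pred I) (A : I -> {set T}) (n : nat) :
  (forall i, P i -> n <= #|A i|) ->
  (forall i j v, P i -> P j -> v \in A i -> v \in A j -> i = j) ->
  #|P| * n <= #|T|.
Proof.
move=> large disj.
have : \sum_(i | P i) n <= \sum_(i | P i) #|A i| by apply: leq_sum.
rewrite sum_nat_const => /leq_trans; apply.
under eq_bigr do rewrite -sum1_card.
rewrite (exchange_big_dep predT) //= -sum1_card; apply: leq_sum => v _.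
rewrite sum1_card; apply/card_le1P => i; rewrite unfold_in /= => /andP[Pi vi] j.
rewrite inE unfold_in /=; apply/idP/eqP => [/andP[Pj vj]|->]; last by rewrite Pi.
exact: (disj j i v).
Qed.

Definition sylvester_like (V E : finType) (src tgt : E -> V) : Prop :=
  exists f : E -> SE,
    4 * #|V| <= 5 * #|Vf src tgt f| /\
    (forall v : V, v \notin Vf src tgt f ->
       exists e e' : E, [/\ e \in incident src tgt v, e' \in incident src tgt v,
                           e != e' & f e = f e']).

Section TriangleFree.
Variables (V E : finType) (src tgt : E -> V).
Hypotheses (Hloop : loopless src tgt) (Hcubic : cubic src tgt).
Local Notation inc := (incident src tgt).
Local Notation joins := (joins src tgt).
Local Notation Vf := (Vf src tgt).
Local Notation minimal := (@minimal V E src tgt).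
Local Notation misses := (@misses V E src tgt).
Local Notation chain := (@chain V E src tgt).
Implicit Types (c : colouring E) (a b : 'I_3) (e g h k : E) (v x y z p q r : V).

(** The last clause forbids edges parallel to a side; they would become loops under contraction. *)
Definition simple_triangle x y z e1 e2 e3 : bool :=
  [&& joins e1 x y, joins e2 x z, joins e3 y z
    & [forall h, (src h \in [:: x; y; z]) && (tgt h \in [:: x; y; z]) ==>
                 (h \in [:: e1; e2; e3])]].

Lemma Vf_star (f : E -> SE) v e1 e2 e3 : inc v = [set e1; e2; e3] ->
  S_star (f e1) (f e2) (f e3) -> v \in Vf f.
Proof. by move=> vE; rewrite /Defs.Vf inE vE !imsetU !imset_set1. Qed.

Lemma incident3 v e1 e2 e3 : e1 \in inc v -> e2 \in inc v -> e3 \in inc v ->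
  e1 != e2 -> e1 != e3 -> e2 != e3 -> inc v = [set e1; e2; e3].
Proof.
move=> v1 v2 v3 e12 e13 e23; have [g [g1 g2 gE]] := third_edge Hcubic e12 v1 v2.
by move: v3; rewrite gE !inE eq_sym (negPf e13) eq_sym (negPf e23) => /eqP->.
Qed.

Lemma joins_neq_edge k k' p q r : joins k p q -> joins k' p r -> q != r -> k != k'.
Proof.
move=> j j' qr; apply: contraNneq qr => kk'; rewrite -kk' in j'.
case/orP: (joins_end j (joins_incr j')) => /eqP rE; last by rewrite rE.
by move: (joins_neq j'); rewrite rE eqxx.
Qed.

(* [p], [q], [r] play the roles of x_i, y_i, z_i. *)
Lemma sylvester_block k h k1 k2 p q r :
  joins k p q -> joins h p q -> h != k -> joins k1 p r -> joins k2 q r ->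
  exists g, [/\ g \in inc r, g \notin [set k; h; k1; k2] &
    forall i, i < 3 -> exists loc : E -> SE, forall f : E -> SE,
      (forall e, e \in [set k; h; k1; k2] -> f e = loc e) -> f g = S_edge i 4 ->
      [/\ p \in Vf f, q \in Vf f & r \in Vf f]].
Proof.
move=> jk jh hk j1 j2.
have jk' : joins k q p by rewrite joinsC.
have jh' : joins h q p by rewrite joinsC.
have j1' : joins k1 r p by rewrite joinsC.
have j2' : joins k2 r q by rewrite joinsC.
have pr := joins_neq j1; have qr := joins_neq j2; have pq := joins_neq jk.
have kk1 : k != k1 := joins_neq_edge jk j1 qr.
have hk1 : h != k1 := joins_neq_edge jh j1 qr.
have kk2 : k != k2 := joins_neq_edge jk' j2 pr.
have hk2 : h != k2 := joins_neq_edge jh' j2 pr.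
have k12 : k1 != k2 := joins_neq_edge j1' j2' pq.
have kh : k != h by rewrite eq_sym.
have pE := incident3 (joins_incl jk) (joins_incl jh) (joins_incl j1) kh kk1 hk1.
have qE := incident3 (joins_incr jk) (joins_incr jh) (joins_incl j2) kh kk2 hk2.
have [g [g1 g2 rE]] := third_edge Hcubic k12 (joins_incr j1) (joins_incr j2).
have gr : g \in inc r by rewrite rE !inE eqxx orbT.
have notr e : joins e p q -> e \notin inc r.
  move=> je; apply/negP => /(joins_end je).
  by rewrite !(eq_sym r) (negPf pr) (negPf qr).
exists g; split=> //.
  rewrite !inE (negPf g1) (negPf g2) !orbF negb_or.
  by apply/andP; split; apply: contraTneq gr => ->; apply: notr.
(* The block index stays free: the spoke already assigned to the leaving edge [g] will fix it. *)
move=> i i3; exists (fun e => if e == k then S_edge i 0 else if e == h then S_edge i 1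
  else if e == k1 then S_edge i 2 else S_edge i 3) => f floc fg.
have fk : f k = S_edge i 0 by rewrite floc /= ?eqxx // !inE eqxx.
have fh : f h = S_edge i 1 by rewrite floc /= ?(negPf hk) ?eqxx // !inE eqxx ?orbT.
have f1 : f k1 = S_edge i 2.
  rewrite floc /=; last by rewrite !inE eqxx ?orbT.
  by rewrite (eq_sym k1 k) (eq_sym k1 h) (negPf kk1) (negPf hk1) eqxx.
have f2 : f k2 = S_edge i 3.
  rewrite floc /=; last by rewrite !inE eqxx ?orbT.
  by rewrite !(eq_sym k2) (negPf kk2) (negPf hk2) (negPf k12).
split.
- by apply: (Vf_star pE); rewrite fk fh f1; apply: S_star_x.
- by apply: (Vf_star qE); rewrite fk fh f2; apply: S_star_y.
- by apply: (Vf_star rE); rewrite f1 f2 fg; apply: S_star_z.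
Qed.

(** Starting from [src e] is no restriction: by [ends_connected] the chain contains [tgt e] in a
    minimal colouring. *)
Definition in_chain c e v : Prop := exists a b,
  [/\ misses c (src e) a, misses c (tgt e) b & connect (chain c a b) (src e) v].

Lemma in_chain_disjoint c e e' v : minimal c -> c e = None -> c e' = None ->
  in_chain c e v -> in_chain c e' v -> e = e'.
Proof.
move=> cm ce ce' [a [b [mx my xv]]] [a' [b' [mx' my' xv']]].
apply/eqP/contraT => ee'; exfalso.
exact: (chains_disjoint Hloop Hcubic cm ce (joins_src_tgt Hloop e) mx my
  ce' (joins_src_tgt Hloop e') mx' my' ee' xv xv').
Qed.

(* [d] consists of part of the chain of [e], a set of edges to be recoloured (empty when
   that part is large enough to pay for one bad vertex), and their new colours. *)
Definition local_colouring c e (f0 : E -> SE) (d : {set V} * {set E} * (E -> SE)) : Prop :=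
  [/\ tgt e \in d.1.1, forall v, v \in d.1.1 -> in_chain c e v,
      forall h v, h \in d.1.2 -> h \in inc v -> v \in d.1.1
    & (d.1.2 = set0 /\ 5 <= #|d.1.1|) \/
      (forall f : E -> SE, (forall h, h \in d.1.2 -> f h = d.2 h) ->
        (forall h v, v \in d.1.1 -> h \in inc v -> h \notin d.1.2 -> f h = f0 h) ->
        d.1.1 \subset Vf f)].

Hypothesis no_triangle : forall x y z e1 e2 e3, ~~ simple_triangle x y z e1 e2 e3.

(** The chain continues from [x] to [z] and from [y] to [z']. If [z = z'], the triangle has a
    parallel edge and becomes a block of S. Otherwise it goes on from [z] to a fifth vertex [u]. *)
Lemma local_structure c e (f0 : E -> SE) : minimal c -> c e = None ->
  (forall h, exists2 i, i < 3 & f0 h = S_edge i 4) ->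
  exists d, local_colouring c e f0 d.
Proof.
move=> cm ce f0P; have [x xE] : exists x, src e = x by exists (src e).
have [y yE] : exists y, tgt e = y by exists (tgt e).
have jxy : joins e x y by rewrite -xE -yE joins_src_tgt.
have [a mx] := exists_misses Hcubic ce (joins_incl jxy).
have [b my] := exists_misses Hcubic ce (joins_incr jxy).
have ab := misses_neq cm ce jxy mx my.
have jyx : joins e y x by rewrite joinsC.
have [f1 [z [j1 c1]]] : exists h w, joins h x w /\ c h = Some b.
  exact: (misses_sees Hloop cm ce jyx my).
have [f2 [z' [j2 c2]]] := misses_sees Hloop cm ce jxy mx.
have Kx : connect (chain c a b) x x := connect0 _ _.
have Ky := ends_connected Hloop cm ce jxy mx my.
have Kz : connect (chain c a b) x z.
  by apply/connect1/(chain_edge j1); rewrite c1 eqxx orbT.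
have Kz' : connect (chain c a b) x z'.
  by apply: connect_trans Ky _; apply/connect1/(chain_edge j2); rewrite c2 eqxx.
have in_chain_of v : connect (chain c a b) x v -> in_chain c e v.
  by move=> xv; exists a, b; rewrite xE yE.
have zy : z != y.
  by apply/eqP => zy; apply: (missesP _ _ _ _ _ my) c1; rewrite -zy (joins_incr j1).
have z'x : z' != x.
  by apply/eqP => zx; apply: (missesP _ _ _ _ _ mx) c2; rewrite -zx (joins_incr j2).
have xy := joins_neq jxy; have xz := joins_neq j1; have yz' := joins_neq j2.
have [zz'|zz'] := eqVneq z z'.
  (* The extra edge [h] may be parallel to any side, so the triangle is taken in any order. *)
  have block k h k1 k2 p q r : perm_eq [:: x; y; z] [:: p; q; r] ->
      joins k p q -> joins h p q -> h != k -> joins k1 p r -> joins k2 q r ->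
      exists d, local_colouring c e f0 d.
    move=> pE jk jh hk jk1 jk2.
    have [g [gr gI gP]] := sylvester_block jk jh hk jk1 jk2.
    have [i i3 f0g] := f0P g; have [loc locP] := gP i i3.
    have AE v : (v \in [set p; q; r]) = (v \in [:: x; y; z]).
      by rewrite (perm_mem pE) !inE orbA.
    exists ([set p; q; r], [set k; h; k1; k2], loc); split => /=.
    - by rewrite AE yE !inE eqxx orbT.
    - by move=> v; rewrite AE !inE => /or3P[]/eqP->; apply: in_chain_of.
    - move=> h' v hI hv; move: hI; rewrite !inE => /orP[/orP[/orP[]|]|] /eqP hE; rewrite hE in hv.
      + by rewrite (joins_end jk hv).
      + by rewrite (joins_end jh hv).
      + by have := joins_end jk1 hv; case/orP => ->; rewrite ?orbT.
      + by have := joins_end jk2 hv; case/orP => ->; rewrite ?orbT.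
    right=> f fI fA; have [|pV qV rV] := locP f fI.
      by rewrite (fA g r) // !inE eqxx orbT.
    by apply/subsetP => v /setUP[/set2P[]|/set1P] ->.
  have j2z : joins f2 y z by rewrite zz'.
  have jzx : joins f1 z x by rewrite joinsC.
  have jzy : joins f2 z y by rewrite joinsC.
  have := no_triangle x y z e f1 f2.
  rewrite /simple_triangle jxy j1 j2z /= => /forallPn[h]; rewrite negb_imply.
  case/andP=> hin; rewrite !inE !negb_or => /and3P[he h1 h2].
  have [p [q [jh pqin]]] : exists p q, joins h p q /\
      (p \in [:: x; y; z]) && (q \in [:: x; y; z]).
    by exists (src h), (tgt h); rewrite joins_src_tgt.
  have {hin jh pqin} : [|| joins h x y, joins h x z | joins h y z].
    have := joins_neq jh.
    case/andP: pqin; rewrite !inE => /or3P[]/eqP pE /or3P[]/eqP qE;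
      rewrite pE qE in jh *; rewrite ?eqxx ?jh ?orbT //;
      by rewrite joinsC in jh; rewrite jh ?orbT.
  case/or3P=> jh.
  - exact: (block e h f1 f2 x y z).
  - apply: (block f1 h e f2 x z y) => //.
    by rewrite -cat1s -[[:: x; z; y]]cat1s perm_cat2l (perm_catC [:: y] [:: z]).
  - apply: (block f2 h e f1 y z x) => //.
    by rewrite (perm_catC [:: x] [:: y; z]).
have nfe : f1 != e by apply: contra_eqN c1 => /eqP->; rewrite ce.
(* Shift [e] to [f1]: [x] still misses [a], so by minimality [z] must see it. *)
have [f3 [u [j3 c3]]] : exists h w, joins h z w /\ c h = Some a.
  pose s := shift c e f1 b.
  have sm : minimal s := shift_minimal cm ce jxy (joins_incl j1) c1 my.
  have s1 : s f1 = None by rewrite ffunE eqxx.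
  have [h [w [jh sh]]] := misses_sees Hloop sm s1 j1 (misses_shift_other e f1 ab mx).
  exists h, w; split=> //; move: sh; rewrite ffunE; case: eqP => // _.
  by case: eqP => // _ [ba]; rewrite ba eqxx in ab.
have pc := proj1 cm.
exists ([set v in [:: x; y; z; z'; u]], set0, fun=> inord 0); split => /=.
- by rewrite yE !inE eqxx orbT.
- move=> v; rewrite inE => vin; apply: in_chain_of; move: vin.
  rewrite !inE => /or4P[|||/orP[]] /eqP-> //.
  by apply: connect_trans Kz _; apply/connect1/(chain_edge j3); rewrite c3 eqxx.
- by move=> h v; rewrite in_set0.
left; split=> //.
have zu := joins_neq j3.
have ux : u != x.
  by apply/eqP => ux; apply: (missesP _ _ _ _ _ mx) c3; rewrite -ux (joins_incr j3).
(* Both edges have colour [a], so a common end would make them equal, yet [z] is no end of [f2]. *)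
have f32 v : f3 \in inc v -> f2 \in inc v -> False.
  move=> v3 v2; have f3E := (proper_colouringP _ _ _ pc) v f3 f2 a v3 v2 c3 c2.
  have := joins_end j2; rewrite -f3E => /(_ z (joins_incl j3)).
  by rewrite (negPf zy) (negPf zz').
have uy : u != y by apply/eqP => uy; apply: (f32 y _ (joins_incl j2)); rewrite -uy (joins_incr j3).
have uz' : u != z'.
  by apply/eqP => uz'; apply: (f32 z' _ (joins_incr j2)); rewrite -uz' (joins_incr j3).
suff /card_uniqP s5 : uniq [:: x; y; z; z'; u] by rewrite cardsE s5.
rewrite /= !inE !negb_or xy xz (eq_sym x z') z'x (eq_sym x u) ux (eq_sym y z) zy yz'.
by rewrite (eq_sym y u) uy zz' zu (eq_sym z' u) uz'.
Qed.

(** * Colouring by spokes and counting bad vertices *)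

Definition spoke (a : 'I_3) : SE := S_edge a 4.

(** An uncoloured edge takes a colour missing at its source, leaving only its target in conflict.
    The default [ord0] is never reached, by [exists_misses]. *)
Definition colour_of c e : 'I_3 :=
  odflt (odflt ord0 [pick a | misses c (src e) a]) (c e).

Lemma colour_of_Some c e a : c e = Some a -> colour_of c e = a.
Proof. by rewrite /colour_of => ->. Qed.

Lemma colour_of_None c e : c e = None -> misses c (src e) (colour_of c e).
Proof.
move=> ce; rewrite /colour_of ce /=; case: pickP => [a //|none].
have [a] := exists_misses Hcubic ce (joins_incl (joins_src_tgt Hloop e)).
by rewrite none.
Qed.

(** At most one uncoloured edge meets [v], and its new colour is missing at [v]. So the three
    colours at [v] are distinct and give the star of the centre of S. *)
Lemma Vf_spokes c v : minimal c -> (forall e, c e = None -> tgt e != v) ->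
  v \in Vf (spoke \o colour_of c).
Proof.
move=> cm notgt; have pc := proj1 cm.
have None_Some e h : e \in inc v -> h \in inc v -> c e = None -> c h <> None ->
    colour_of c e <> colour_of c h.
  move=> ev hv ce; case ch: (c h) => [a|//] _; rewrite (colour_of_Some ch) => eE.
  have := colour_of_None ce; rewrite eE.
  have /eqP-> : src e == v by move: ev; rewrite inE (negPf (notgt e ce)) orbF.
  by move/missesP/(_ h hv); rewrite ch.
have inj : {in inc v &, injective (colour_of c)}.
  move=> e h ev hv eh; case ce: (c e) => [a|]; case ch: (c h) => [b|].
  - apply: ((proper_colouringP _ _ _ pc) v e h a ev hv ce).
    by rewrite ch -(colour_of_Some ch) -eh (colour_of_Some ce).
  - by case: (None_Some h e hv ev ch _ (esym eh)); rewrite ce.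
  - by case: (None_Some e h ev hv ce _ eh); rewrite ch.
  - exact: (uncoloured_matching Hloop Hcubic cm ce ch ev hv).
have imT : colour_of c @: inc v = [set: 'I_3].
  by apply/eqP; rewrite eqEcard subsetT cardsT card_ord (card_in_imset inj) Hcubic.
have T3 : [set: 'I_3] = [set inord 0; inord 1; inord 2].
  apply/setP => -[[|[|[|m]]] mlt] //; rewrite !inE -!val_eqE /= !inordK //.
rewrite /Defs.Vf inE imset_comp imT T3 !imsetU !imset_set1.
by have := S_star_c; rewrite /S_star /spoke !inordK.
Qed.

Lemma triangle_free_case : sylvester_like src tgt.
Proof.
have [c cm] := minimal_exists src tgt.
pose f0 := spoke \o colour_of c.
have [d dP] : exists d : E -> {set V} * {set E} * (E -> SE),
    forall e, c e = None -> local_colouring c e f0 (d e).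
  apply: (@fin_all_exists _ (fun=> _) (fun e d => c e = None -> local_colouring c e f0 d)) => e.
  (* Coloured edges get a dummy value. *)
  case ce: (c e) => [a|]; first by exists (set0, set0, f0).
  have [|d dP] := @local_structure c e f0 cm ce; last by exists d.
  by move=> h; exists (colour_of c h).
pose A e := (d e).1.1; pose J e := (d e).1.2.
have disj e e' v : c e = None -> c e' = None -> v \in A e -> v \in A e' -> e = e'.
  move=> ce ce' vA vA'; apply: (in_chain_disjoint cm ce ce' (v := v)).
    by have [_ AK _ _] := dP e ce; apply: AK.
  by have [_ AK _ _] := dP e' ce'; apply: AK.
have J_A e h v : c e = None -> h \in J e -> h \in inc v -> v \in A e.
  by move=> ce; have [_ _ JA _] := dP e ce; apply: JA.
(* The choice made by [pick] is forced: an edge in two sets [J e] would put its ends in two disjoint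
   sets [A e]. *)
pose f h := if [pick e | (c e == None) && (h \in J e)] is Some e then (d e).2 h else f0 h.
have fJ e h : c e = None -> h \in J e -> f h = (d e).2 h.
  move=> ce hJ; rewrite /f; case: pickP => [e' /andP[/eqP ce' hJ']|/(_ e)]; last first.
    by rewrite ce eqxx hJ.
  have hs := joins_incl (joins_src_tgt Hloop h).
  by rewrite (disj e' e (src h) ce' ce) //; apply: J_A hs.
have fN h : (forall e, c e = None -> h \notin J e) -> f h = f0 h.
  move=> hN; rewrite /f; case: pickP => // e /andP[/eqP ce].
  by rewrite (negPf (hN e ce)).
have large e v : c e = None -> v \in A e -> v \notin Vf f -> J e = set0 /\ 5 <= #|A e|.
  move=> ce vA vf; case: (dP e ce) => _ _ _ [//|AV].
  case/negP: vf; apply: (subsetP (AV f _ _)) => // [h|h w wA hw hN]; first exact: fJ.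
  apply: fN => e' ce'; apply: contra hN => hJ'.
  by rewrite -(disj e' e w) //; apply: J_A hJ' hw.
have ff0 v h : v \notin Vf f -> h \in inc v -> f h = f0 h.
  move=> vf hv; apply: fN => e ce; apply/negP => hJ.
  have [J0 _] := large e v ce (J_A e h v ce hJ hv) vf.
  by move: hJ; rewrite /J in J0 *; rewrite J0 in_set0.
have bad v : v \notin Vf f -> exists2 e, c e = None & tgt e = v.
  move=> vf; suff : [exists e, (c e == None) && (tgt e == v)].
    by case/existsP=> e /andP[/eqP ce /eqP ev]; exists e.
  apply: contraT => /existsPn none; case/negP: vf.
  have : v \in Vf f0.
    by apply: Vf_spokes => // e ce; have := none e; rewrite ce eqxx.
  have [//|vf] := boolP (v \in Vf f).
  have fE : f @: inc v = f0 @: inc v by apply: eq_in_imset => h; apply: ff0.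
  by rewrite /Defs.Vf in vf *; move: vf; rewrite !inE fE => /negPf->.
have tgtA e : c e = None -> tgt e \in A e by move=> ce; case: (dP e ce).
exists f; split; last first.
  move=> v vf; have [e ce ev] := bad v vf.
  have jst := joins_src_tgt Hloop e.
  (* The colour borrowed from [src e] is already present at [v], on the edge [h] repeating it. *)
  have [h [w [jh ch]]] := misses_sees Hloop cm ce jst (colour_of_None ce).
  rewrite ev in jh jst; exists e, h; split.
  - exact: joins_incr jst.
  - exact: joins_incl jh.
  - by apply: contra_eqN ch => /eqP<-; rewrite ce.
  - rewrite !(ff0 v) ?(joins_incr jst) ?(joins_incl jh) // /f0 /=.
    by rewrite (colour_of_Some ch).
pose P := [pred e | (c e == None) && (5 <= #|A e|)].
have cardP : #|P| * 5 <= #|V|.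
  apply: (leq_card_disjoint (A := A)) => [e /andP[]//|e e' v].
  by move=> /andP[/eqP ce _] /andP[/eqP ce' _]; apply: disj.
have badP : #|~: Vf f| <= #|P|.
  apply: leq_trans (leq_imset_card tgt P); apply/subset_leq_card/subsetP => v.
  rewrite in_setC => vf; have [e ce ev] := bad v vf.
  apply/imsetP; exists e => //; rewrite inE ce eqxx /=.
  by have [] := large e v ce _ vf; rewrite // -ev tgtA.
(* Five times the number of bad vertices is at most [#|V|], the sum of good and bad. *)
have := leq_trans (leq_mul badP (leqnn 5)) cardP.
rewrite -(cardsC (Vf f)); move: #|_| #|_| => m n.
by rewrite mulnSr leq_add2r mulnC mulnDr [5 * m]mulSnr leq_add2l.
Qed.

End TriangleFree.

(** * Contraction of a triangle *)

(** What the theorem demands at a bad vertex, in terms of the images of its three edges. *)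
Definition repeats (T : eqType) (p q r : T) : bool := [|| p == q, p == r | q == r].

(** A star is copied to all three corners by giving each side the colour of the edge leaving the
    opposite corner. If two of [p], [q], [r] agree, a star through their common value makes two
    corners good, and the third sees a repetition. The 2 pays for the two vertices lost in the
    contraction. *)
Lemma triangle_colours (p q r : SE) : S_star p q r || repeats p q r ->
  exists s1 s2 s3 : SE,
    [/\ S_star s1 s2 p || repeats s1 s2 p, S_star s1 s3 q || repeats s1 s3 q,
        S_star s2 s3 r || repeats s2 s3 r
      & S_star p q r + 2 <= S_star s1 s2 p + S_star s1 s3 q + S_star s2 s3 r].
Proof.
case: (boolP (S_star p q r)) => [st _|_ /= /or3P[]/eqP E].
- exists r, q, p; rewrite (S_starC r q) (S_starAC q r p) (S_starC q p r) st.
  by rewrite (S_starC r p q) (S_starAC p r q) st.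
- have [s [t st]] := S_star_through p; exists s, t, t.
  rewrite -E (S_starAC s t p) (S_starC s p t) st /repeats eqxx.
  by rewrite !orTb !orbT; split.
- have [s [t st]] := S_star_through p; exists t, s, t.
  rewrite -E (S_starAC s t p) (S_starC s p t) st (S_starC t s) (S_starAC s t p) (S_starC s p t) st.
  by rewrite /repeats eqxx !orbT; split; rewrite // addnAC leq_addr.
- have [s [t st]] := S_star_through q; exists t, t, s.
  rewrite -E (S_starC t s) (S_starAC s t q) (S_starC s q t) st /repeats eqxx.
  by rewrite /=; split; rewrite ?orbT // -addnA leq_addl.
Qed.

Section Contraction.
Variables (V E : finType) (src tgt : E -> V).
Hypotheses (Hloop : loopless src tgt) (Hcubic : cubic src tgt).
Local Notation inc := (incident src tgt).
Local Notation joins := (joins src tgt).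
Variables (x y z : V) (e1 e2 e3 : E).
Hypothesis triangle : simple_triangle src tgt x y z e1 e2 e3.

Let j1 : joins e1 x y. Proof. by case/and4P: triangle. Qed.
Let j2 : joins e2 x z. Proof. by case/and4P: triangle. Qed.
Let j3 : joins e3 y z. Proof. by case/and4P: triangle. Qed.

Lemma triangle_edge h u v : joins h u v -> u \in [:: x; y; z] -> v \in [:: x; y; z] ->
  h \in [:: e1; e2; e3].
Proof.
move=> jh uD vD; case/and4P: triangle => _ _ _ /forallP/(_ h)/implyP; apply.
have send := joins_end jh (joins_incl (joins_src_tgt Hloop h)).
have tend := joins_end jh (joins_incr (joins_src_tgt Hloop h)).
by case/orP: send => /eqP->; case/orP: tend => /eqP->; rewrite ?uD ?vD.
Qed.

Lemma triangle_third (a b c : V) (k l m : E) : joins k a b -> joins l a c -> joins m b c ->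
  perm_eq [:: a; b; c] [:: x; y; z] -> perm_eq [:: k; l; m] [:: e1; e2; e3] ->
  exists h, [/\ inc a = [set k; l; h], h \notin [:: e1; e2; e3], h != k & h != l].
Proof.
move=> jk jl jm vP eP; have kl := joins_neq_edge jk jl (joins_neq jm).
have [h [hk hl aE]] := third_edge Hcubic kl (joins_incl jk) (joins_incl jl).
exists h; split=> //; rewrite -(perm_mem eP) !inE (negPf hk) (negPf hl) /=.
apply/eqP => hm; have ha : m \in inc a by rewrite -hm aE !inE eqxx orbT.
have := joins_end jm ha; rewrite (negPf (joins_neq jk)).
by rewrite (negPf (joins_neq jl)).
Qed.

Definition cV : finType := {v : V | (v != y) && (v != z)}.
Definition cE : finType := {e : E | e \notin [:: e1; e2; e3]}.

Lemma x_cV : (x != y) && (x != z).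
Proof. by rewrite (joins_neq j1) (joins_neq j2). Qed.

Definition apex : cV := exist _ x x_cV.
(** The default of [insubd] sends [y] and [z] to [x], which stands for the whole triangle. *)
Definition proj (v : V) : cV := insubd apex v.
Definition csrc (e : cE) : cV := proj (src (val e)).
Definition ctgt (e : cE) : cV := proj (tgt (val e)).
Local Notation cinc := (incident csrc ctgt).

Lemma proj_eq (u : V) (v : cV) :
  (proj u == v) = if v == apex then u \in [:: x; y; z] else u == val v.
Proof.
have -> : (v == apex) = (val v == x) by rewrite -val_eqE.
rewrite -val_eqE val_insubd /= !inE.
case: (eqVneq (val v) x) => [->|vx].
  by case: (eqVneq u x) => [->|ux]; rewrite ?x_cV ?eqxx //=;
    case: (eqVneq u y) => [->|uy] /=; rewrite ?eqxx ?orbT //;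
    case: (eqVneq u z) => [->|uz] /=; rewrite ?eqxx ?(negPf ux).
case: ifP => // /negbT; rewrite negb_and !negbK (eq_sym x) (negPf vx) => uyz.
apply/esym/negP => /eqP uv; case/andP: (valP v) => /negPf vy /negPf vz.
by move: uyz; rewrite uv vy vz.
Qed.

Lemma cinc_apex (e : cE) : (e \in cinc apex) =
  (src (val e) \in [:: x; y; z]) || (tgt (val e) \in [:: x; y; z]).
Proof. by rewrite inE !proj_eq eqxx. Qed.

Lemma cinc_other (v : cV) (e : cE) : v != apex -> (e \in cinc v) = (val e \in inc (val v)).
Proof. by move=> va; rewrite !inE !proj_eq (negPf va). Qed.

(** A loop would come from an edge inside the triangle other than its sides. *)
Lemma contraction_loopless : loopless csrc ctgt.
Proof.
move=> e; apply/negP; rewrite proj_eq; case: ifP => [/eqP tE sD|/negbT nt sE].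
  have tD : tgt (val e) \in [:: x; y; z].
    by have := proj_eq (tgt (val e)) apex; rewrite eqxx => <-; rewrite -tE.
  by have := valP e; rewrite (triangle_edge (joins_src_tgt Hloop _) sD tD).
case/eqP: (Hloop (val e)); rewrite (eqP sE) /= val_insubd; case: ifP => // tyz.
by move: nt; rewrite -val_eqE /= val_insubd tyz eqxx.
Qed.

Lemma cinc_card v' (S : {set E}) : val @: cinc v' = S -> #|cinc v'| = #|S|.
Proof. by move=> <-; rewrite card_imset //; apply: val_inj. Qed.

Lemma cinc_otherE (v : cV) : v != apex -> val @: cinc v = inc (val v).
Proof.
move=> va; apply/setP => h; apply/imsetP/idP => [[e ev ->]|hv].
  by rewrite -cinc_other.
have hP : h \notin [:: e1; e2; e3].
  have vD : val v \notin [:: x; y; z].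
    by case/andP: (valP v) => vy vz; rewrite !inE !negb_or -[_ == x]/(v == apex) va vy.
  apply: contra vD; rewrite !inE => /or3P[]/eqP hE; rewrite hE in hv.
  - by case/orP: (joins_end j1 hv) => ->; rewrite ?orbT.
  - by case/orP: (joins_end j2 hv) => ->; rewrite ?orbT.
  - by case/orP: (joins_end j3 hv) => ->; rewrite ?orbT.
by exists (Sub h hP); rewrite ?cinc_other.
Qed.

(** The edges [hx], [hy], [hz] leaving the corners are distinct, so the contraction is cubic; a map
    for it is kept off the triangle and extended by [triangle_colours]. *)
Lemma sylvester_like_contraction :
  (cubic csrc ctgt -> sylvester_like csrc ctgt) -> sylvester_like src tgt.
Proof.
have j1' : joins e1 y x by rewrite joinsC.
have j2' : joins e2 z x by rewrite joinsC.
have j3' : joins e3 z y by rewrite joinsC.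
have xy := joins_neq j1; have xz := joins_neq j2; have yz := joins_neq j3.
have [hx [xE hxN hx1 hx2]] := triangle_third j1 j2 j3 (perm_refl _) (perm_refl _).
have [hy [yE hyN hy1 hy3]] : exists h, [/\ inc y = [set e1; e3; h],
    h \notin [:: e1; e2; e3], h != e1 & h != e3].
  apply: (triangle_third j1' j3 j2); first exact: (permEl (perm_catCA [:: y] [:: x] [:: z])).
  by rewrite -cat1s -[[:: e1; e2; e3]]cat1s perm_cat2l (perm_catC [:: e3] [:: e2]).
have [hz [zE hzN hz2 hz3]] : exists h, [/\ inc z = [set e2; e3; h],
    h \notin [:: e1; e2; e3], h != e2 & h != e3].
  apply: (triangle_third j2' j3' j1); first exact: (permEl (perm_catC [:: z] [:: x; y])).
  exact: (permEl (perm_catC [:: e2; e3] [:: e1])).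
have inD u h : h \in inc u -> u \in [:: x; y; z] -> h \notin [:: e1; e2; e3] ->
    forall v, h \in inc v -> v \in [:: x; y; z] -> u = v.
  move=> hu uD hN v hv vD; apply/eqP/contraT => uv; case/negP: hN.
  by apply: (@triangle_edge h u v) => //; rewrite joinsE hu hv.
have hxi : hx \in inc x by rewrite xE !inE eqxx orbT.
have hyi : hy \in inc y by rewrite yE !inE eqxx orbT.
have hzi : hz \in inc z by rewrite zE !inE eqxx orbT.
have xD : x \in [:: x; y; z] by rewrite !inE eqxx.
have yD : y \in [:: x; y; z] by rewrite !inE eqxx orbT.
have zD : z \in [:: x; y; z] by rewrite !inE eqxx !orbT.
have hxy : hx != hy.
  by apply: contraNneq xy => hE; apply/eqP/(inD x hx) => //; rewrite hE.
have hxz : hx != hz.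
  by apply: contraNneq xz => hE; apply/eqP/(inD x hx) => //; rewrite hE.
have hyz : hy != hz.
  by apply: contraNneq yz => hE; apply/eqP/(inD y hy) => //; rewrite hE.
have apexE : val @: cinc apex = [set hx; hy; hz].
  apply/setP => h; apply/imsetP/idP => [[e ev hE]|].
    have eN := valP e; rewrite /= -hE in eN.
    have outer u : h \in inc u -> u \in [:: x; y; z] -> h \in [set hx; hy; hz].
      move=> hu; rewrite !inE => /or3P[]/eqP uE; move: hu eN; rewrite uE ?xE ?yE ?zE !inE;
      by case: (h == e1); case: (h == e2); case: (h == e3); rewrite //= => ->; rewrite ?orbT.
    by move: ev; rewrite cinc_apex -hE; case/orP; apply: outer; rewrite inE eqxx ?orbT.
  have ends u : u \in [:: x; y; z] -> h \in inc u ->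
      (src h \in [:: x; y; z]) || (tgt h \in [:: x; y; z]).
    by move=> uD; rewrite [h \in _]inE => /orP[]/eqP->; rewrite uD ?orbT.
  move=> hin; have hN : h \notin [:: e1; e2; e3].
    by move: hin => /setUP[/set2P[]|/set1P] ->.
  exists (Sub h hN) => //; rewrite cinc_apex /=.
  by move: hin => /setUP[/set2P[]|/set1P] hE; [apply: (ends x)|apply: (ends y)|apply: (ends z)];
    rewrite // hE.
have ccubic : cubic csrc ctgt.
  move=> v; have [->|va] := eqVneq v apex; last first.
    by rewrite (cinc_card (cinc_otherE va)) Hcubic.
  rewrite (cinc_card apexE) setUC cardsU1 cards2 !inE negb_or hxy.
  by rewrite (eq_sym hz hx) hxz (eq_sym hz hy) hyz.
case/(_ ccubic) => f' [f'card f'bad].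
pose cx : cE := Sub hx hxN.
(* The default [cx] is used only on the three sides, where [f] overrides [f0]. *)
pose f0 h := f' (insubd cx h).
have f0val e : f0 (val e) = f' e by rewrite /f0 valKd.
set p := f0 hx; set q := f0 hy; set r := f0 hz.
have f0im v : f0 @: (val @: cinc v) = f' @: cinc v.
  by rewrite -imset_comp; apply: eq_imset => e /=; apply: f0val.
have apexVf : (apex \in Vf csrc ctgt f') = S_star p q r.
  by rewrite inE -f0im apexE !imsetU !imset_set1.
have : S_star p q r || repeats p q r.
  rewrite -apexVf; case: (boolP (apex \in _)) => //= /f'bad[e [e' [ei e'i ee' fe]]].
  have : val e \in [set hx; hy; hz] by rewrite -apexE imset_f.
  have : val e' \in [set hx; hy; hz] by rewrite -apexE imset_f.
  rewrite -(inj_eq val_inj) in ee'; rewrite -!f0val in fe; move: ee' fe.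
  move: (val e) (val e') => k k' kk' fk.
  rewrite /repeats /p /q /r => /setUP[/set2P[]|/set1P] kE /setUP[/set2P[]|/set1P] k'E;
  by move: kk' fk; rewrite kE k'E ?eqxx // => _ ->; rewrite ?eqxx ?orbT.
case/triangle_colours=> s1 [s2 [s3 [okx oky okz card3]]].
pose f h := if h == e1 then s1 else if h == e2 then s2 else if h == e3 then s3 else f0 h.
have fN h : h \notin [:: e1; e2; e3] -> f h = f0 h.
  by rewrite !inE !negb_or /f => /and3P[/negPf-> /negPf-> /negPf->].
have e12 : e1 != e2 := joins_neq_edge j1 j2 yz.
have e13 : e1 != e3 := joins_neq_edge j1' j3 xz.
have e23 : e2 != e3 := joins_neq_edge j2' j3' xy.
have f1 : f e1 = s1 by rewrite /f eqxx.
have f2 : f e2 = s2 by rewrite /f eq_sym (negPf e12) eqxx.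
have f3 : f e3 = s3 by rewrite /f eq_sym (negPf e13) eq_sym (negPf e23) eqxx.
have Vf3 u k l m : inc u = [set k; l; m] -> (u \in Vf src tgt f) = S_star (f k) (f l) (f m).
  by move=> uE; rewrite inE uE !imsetU !imset_set1.
have bad3 u k l m : inc u = [set k; l; m] -> k != l -> m != k -> m != l ->
    S_star (f k) (f l) (f m) || repeats (f k) (f l) (f m) -> u \notin Vf src tgt f ->
    exists e e' : E, [/\ e \in inc u, e' \in inc u, e != e' & f e = f e'].
  move=> uE kl mk ml ok; rewrite (Vf3 u _ _ _ uE) => /negPf nst; move: ok.
  rewrite nst uE /=.
  case/or3P=> /eqP fE; [exists k, l|exists k, m|exists l, m];
    by split; rewrite // ?(eq_sym k m) ?(eq_sym l m) // !inE eqxx ?orbT.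
have Vf_other v : v != apex -> (val v \in Vf src tgt f) = (v \in Vf csrc ctgt f').
  move=> va; rewrite !inE -f0im -(cinc_otherE va); apply: eq_existsb => w; congr (_ == _).
  by apply: eq_in_imset => _ /imsetP[e _ ->]; apply: fN; apply: valP e.
have Vfx : (x \in Vf src tgt f) = S_star s1 s2 p by rewrite (Vf3 _ _ _ _ xE) f1 f2 fN.
have Vfy : (y \in Vf src tgt f) = S_star s1 s3 q by rewrite (Vf3 _ _ _ _ yE) f1 f3 fN.
have Vfz : (z \in Vf src tgt f) = S_star s2 s3 r by rewrite (Vf3 _ _ _ _ zE) f2 f3 fN.
exists f; split; last first.
  move=> u; have [->|ux] := eqVneq u x.
    by apply: (bad3 _ _ _ _ xE) => //; rewrite f1 f2 fN.
  have [->|uy] := eqVneq u y; first by apply: (bad3 _ _ _ _ yE) => //; rewrite f1 f3 fN.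
  have [->|uz] := eqVneq u z; first by apply: (bad3 _ _ _ _ zE) => //; rewrite f2 f3 fN.
  have uP : (u != y) && (u != z) by rewrite uy.
  pose v : cV := Sub u uP; have va : v != apex by rewrite -val_eqE.
  rewrite -[u]/(val v) Vf_other // => /f'bad[e [e' [ei e'i ee' fe]]].
  exists (val e), (val e'); rewrite -!cinc_other // ei e'i (inj_eq val_inj) ee'.
  by split=> //; rewrite !fN ?f0val //; [apply: valP e'|apply: valP e].
have cardV : #|V| = #|cV| + 2.
  rewrite card_sig -(cardC (mem [:: y; z])); rewrite addnC; congr (_ + _).
    by apply: eq_card => u; rewrite !inE negb_or.
  by apply/card_uniqP; rewrite /= inE yz.
(* The apex is traded for the corners [x], [y], [z]; other vertices keep their status. *)
have cardVf : #|Vf csrc ctgt f'| + 2 <= #|Vf src tgt f|.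
  rewrite (cardsD1 apex) apexVf addnAC (cardsD1 x (Vf src tgt f)) Vfx.
  rewrite (cardsD1 y (_ :\ x)) (cardsD1 z (_ :\ y)) !in_setD1 Vfy Vfz.
  rewrite (eq_sym y x) xy (eq_sym z y) yz (eq_sym z x) xz /= !addnA.
  apply: leq_add card3 _; rewrite -(card_imset _ val_inj).
  apply/subset_leq_card/subsetP => _ /imsetP[v + ->].
  rewrite !in_setD1 => /andP[va vVf]; rewrite Vf_other // vVf andbT.
  by case/andP: (valP v) => -> -> /=; rewrite -[_ == x]/(v == apex).
(* Two more vertices, both paid for by good ones, preserve the ratio as 8 is at most 10. *)
rewrite cardV mulnDr; apply: leq_trans (leq_mul (leqnn 5) cardVf).
by rewrite mulnDr leq_add.
Qed.

End Contraction.

(** * Induction on the number of vertices *)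

Theorem theorem6 (V E : finType) (src tgt : E -> V)
  (Hloop : loopless src tgt) (Hcubic : cubic src tgt) :
  exists f : E -> SE,
    4 * #|V| <= 5 * #|Vf src tgt f| /\
    (forall v : V, v \notin Vf src tgt f ->
       exists e e' : E, [/\ e \in incident src tgt v, e' \in incident src tgt v,
                           e != e' & f e = f e']).
Proof.
have [n] := ubnP #|V|; elim: n => // n IH in V E src tgt Hloop Hcubic *.
rewrite ltnS => Vn.
have [|no_triangle] := boolP [exists t : V * V * V, exists s : E * E * E,
  simple_triangle src tgt t.1.1 t.1.2 t.2 s.1.1 s.1.2 s.2].
  case/existsP=> -[[x y] z] /existsP[[[e1 e2] e3]] /= triangle.
  rewrite -/(sylvester_like src tgt).
  apply: (sylvester_like_contraction Hloop Hcubic (triangle := triangle)) => ccubic.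
  apply: IH => //; first exact: contraction_loopless.
  apply: leq_trans Vn; rewrite card_sig; apply: proper_card.
  by apply/properP; split; [apply/subsetP|exists y; rewrite // inE eqxx].
apply: triangle_free_case => // x y z e1 e2 e3; apply: contra no_triangle => triangle.
by apply/existsP; exists (x, y, z); apply/existsP; exists (e1, e2, e3).
Qed.
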